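(* Let $\alpha,\lambda\in\mathbb{R}$ with $\alpha\neq 0$, and let $M$ be a surface in $\mathbb{R}^3$ that is an $\alpha$-self-similar solution of constant $\lambda$, i.e. $H(\mathbf{x})=\alpha\langle N(\mathbf{x}),\mathbf{x}\rangle+\lambda$ for all $\mathbf{x}\in M$. If $M$ is a ruled surface, then $M$ is a cylindrical surface.
   Context: $\mathbb{R}^3$ is Euclidean 3-space with Euclidean metric $\langle\cdot,\cdot\rangle$; surfaces are smooth. For a surface $M\subset\mathbb{R}^3$, $N$ denotes its Gauss map (unit normal field), $\mathbf{x}$ is the position vector, and $H$ is the mean curvature, defined as the trace of the second fundamental form (not divided by 2) with the sign convention that a sphere of radius $r>0$ has $H=2/r$ with respect to the inward normal. Given $\alpha,\lambda\in\mathbb{R}$, $M$ is an $\alpha$-self-similar solution of constant $\lambda$ if $H(\mathbf{x})=\alpha\langle N(\mathbf{x}),\mathbf{x}\rangle+\lambda$ for all $\mathbf{x}\in M$. A ruled surface is a surface that is the union of a one-parameter family of straight lines; it can be parametrized locally by $X(s,t)=\gamma(s)+t\beta(s)$, $t\in\mathbb{R}$, where $\gamma,\beta:I\subset\mathbb{R}\to\mathbb{R}^3$ are smooth curves on an interval $I$ with $|\beta(s)|=1$ for all $s\in I$. The curve $\gamma$ is the directrix, and the lines with direction $\beta(s)$ are the rulings. A ruled surface is cylindrical if its rulings are all parallel to a fixed direction ($\beta$ constant); equivalently, it is invariant under the one-parameter group of translations along that direction. A plane is a cylindrical surface (it can be parametrized with $\beta$ constant, although it also admits local parametrizations of the form $X(s,t)=\gamma(s)+t\beta(s)$,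 $|\beta(s)|=1$, with $\beta$ non-constant). *)

(* Defs.v *)
From HB Require Import structures.
From mathcomp Require Import all_boot all_order all_algebra.
From mathcomp Require Import all_classical all_reals all_analysis.
Set Implicit Arguments.
Unset Strict Implicit.
Unset Printing Implicit Defensive.
Import Order.TTheory GRing.Theory Num.Theory.
Import numFieldNormedType.Exports.
Local Open Scope classical_set_scope.
Local Open Scope ring_scope.

(* The library norm on 'rV[R]_n is the sup norm, so the Euclidean structure is
   introduced separately; both norms give the same topology and derivatives. *)
Definition dot (R : realType) (n : nat) (u v : 'rV[R]_n) : R :=
  \sum_(i < n) u 0 i * v 0 i.

Definition enorm (R : realType) (n : nat) (u : 'rV[R]_n) : R :=
  Num.sqrt (dot u u).

(* [:: v1; ...; vk] |-> 'D_v1 (... ('D_vk f)). *)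
Definition iter_derive (R : realType) (V W : normedModType R)
    (vs : seq V) (f : V -> W) : V -> W :=
  foldr (fun v g => 'D_v g) f vs.

(* C^oo on an open set A: every iterated directional derivative is (Frechet)
   differentiable, hence continuous, at every point of A. *)
Definition smooth_on (R : realType) (V W : normedModType R)
    (A : set V) (f : V -> W) : Prop :=
  forall (vs : seq V) (x : V), A x -> differentiable (iter_derive vs f) x.

Definition partial (R : realType) (i : 'I_2) (X : 'rV[R]_2 -> 'rV[R]_3) :
  'rV[R]_2 -> 'rV[R]_3 := 'D_(delta_mx 0 i) X.

(* (V, X) is a local parametrization of M: a smooth immersion of the open set V
   that is a homeomorphism onto a relatively open subset of M.  Given injectivity
   and continuity, the last clause says that X : V -> M is an open map. *)
Definition local_param (R : realType) (M : set 'rV[R]_3)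
    (V : set 'rV[R]_2) (X : 'rV[R]_2 -> 'rV[R]_3) : Prop :=
  [/\ open V,
      smooth_on V X,
      forall u, V u -> row_free ('J X u),
      {in V &, injective X} &
      forall W : set 'rV[R]_2, open W -> W `<=` V ->
        exists2 U : set 'rV[R]_3, open U & X @` W = M `&` U].

Definition regular_surface (R : realType) (M : set 'rV[R]_3) : Prop :=
  forall p, M p ->
    exists V X, local_param M V X /\ (X @` V) p.

(* N is a smooth unit normal field on M; its values off M are irrelevant. *)
Definition gauss_map (R : realType) (M : set 'rV[R]_3)
    (N : 'rV[R]_3 -> 'rV[R]_3) : Prop :=
  (forall p, M p -> enorm (N p) = 1) /\
  (forall V X, local_param M V X ->
     smooth_on V (N \o X) /\
     forall u i, V u -> dot (N (X u)) (partial i X u) = 0).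

Definition first_form (R : realType) (X : 'rV[R]_2 -> 'rV[R]_3)
    (u : 'rV[R]_2) : 'M[R]_2 :=
  \matrix_(i, j) dot (partial i X u) (partial j X u).

Definition second_form (R : realType) (N : 'rV[R]_3 -> 'rV[R]_3)
    (X : 'rV[R]_2 -> 'rV[R]_3) (u : 'rV[R]_2) : 'M[R]_2 :=
  \matrix_(i, j) dot (partial i (partial j X) u) (N (X u)).

(* h is the trace of the second fundamental form with respect to the metric,
   computed in local parametrizations around p (the value does not depend on the
   parametrization).  The trace is not halved, and with II = <d^2 X, N> a sphere
   of radius r has h = 2 / r for the inward normal. *)
Definition is_mean_curvature (R : realType) (M : set 'rV[R]_3)
    (N : 'rV[R]_3 -> 'rV[R]_3) (p : 'rV[R]_3) (h : R) : Prop :=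
  forall V X u, local_param M V X -> V u -> X u = p ->
    h = \tr (invmx (first_form X u) *m second_form N X u).

Definition self_similar (R : realType) (alpha lambda : R) (M : set 'rV[R]_3)
    (N : 'rV[R]_3 -> 'rV[R]_3) : Prop :=
  forall p, M p -> is_mean_curvature M N p (alpha * dot (N p) p + lambda).

(* X(s, t) = gamma(s) + t beta(s), with u = (s, t). *)
Definition ruled_map (R : realType) (gamma beta : R -> 'rV[R]_3)
    (u : 'rV[R]_2) : 'rV[R]_3 :=
  gamma (u 0 0) + u 0 1 *: beta (u 0 0).

(* M is the union of the complete lines gamma(s) + R beta(s), s in I, and
   X(s, t) = gamma(s) + t beta(s) parametrizes M locally, near every (s, t).
   X need not be globally injective, so closed families of lines are covered by
   periodic gamma and beta. *)
Definition ruling (R : realType) (M : set 'rV[R]_3) (I : set R)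
    (gamma beta : R -> 'rV[R]_3) : Prop :=
  [/\ [/\ open I, is_interval I & I !=set0],
      smooth_on (I : set R^o) gamma /\ smooth_on (I : set R^o) beta,
      forall s, I s -> enorm (beta s) = 1,
      M = ruled_map gamma beta @` [set u : 'rV[R]_2 | I (u 0 0)] &
      forall u : 'rV[R]_2, I (u 0 0) ->
        exists V, V u /\ local_param M V (ruled_map gamma beta)].

Definition ruled_surface (R : realType) (M : set 'rV[R]_3) : Prop :=
  exists I gamma beta, ruling M I gamma beta.

Definition cylindrical_surface (R : realType) (M : set 'rV[R]_3) : Prop :=
  exists I gamma beta, ruling M I gamma beta /\
    exists v : 'rV[R]_3, forall s, I s -> beta s = v.

(* Main.v *)
Require Import Defs.
From mathcomp Require Import all_boot all_order all_algebra.
From mathcomp Require Import all_classical all_reals all_analysis.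
From mathcomp Require Import ring lra.
Set Implicit Arguments.
Unset Strict Implicit.
Unset Printing Implicit Defensive.
Import Order.TTheory GRing.Theory Num.Theory.
Import numFieldNormedType.Exports.
Local Open Scope classical_set_scope.
Local Open Scope ring_scope.

(**
Let the surface be X(s,t) = g(s) + t b(s) with |b| = 1, and write g1, b1, g2, b2
for the derivatives of g and b.  The claim is that b1 vanishes identically, so
that the given rulings are already parallel.

Since X_tt = 0 and |X_t| = 1, multiplying H = alpha <N, x> + lambda by powers of
W = |X_s x X_t| clears the denominators: for each s and every real t,
    P(t) - alpha Q(t) D(t) = +- lambda Q(t)^(3/2),
where Q = W^2 is quadratic in t, P has degree at most 2 and
D = det(X_s, b, g) has degree at most 1 ([ruled_self_similar_eq], squared in
order to remove the sign and the root).  As the rulings are complete lines along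
which X is an immersion, Q is positive on the whole real line.

Fix s with b1 <> 0.  Then Q has degree 2 and no real root, so the square of a
cubic can equal lambda^2 Q^3 only if both vanish ([cubic_sqr_eq_cube]).  Hence
P = alpha Q D as polynomials in t, and comparing the coefficients of t^3 and t^2
([ruled_identity_coefs]) gives
    det(g, b, b1) = 0   and   det(b1, b, b2) = alpha |b1|^2 det(g1, b, g).
The first relation puts g in the span of b and b1.  Differentiating it and using
that X is an immersion, the second one becomes |b1|^2 + alpha <g, b1>^2 = 0
([origin_distance_eq]): all nearby rulings are at distance 1 / sqrt(- alpha)
from the origin.

That relation holds near s and can be differentiated twice.  Substituting the
outcome into P = alpha Q D at the one parameter t where X_s is orthogonal to b1
leaves <g, b1>^2 |b1|^2 = 0 ([ruled_jet_contradiction]), which is impossible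
because <g, b1> = 0 would force b1 = 0.  For motivation, in arc length of b and
with directrix c b1, c constant, this is the computation that the geodesic
curvature k of the spherical curve b satisfies c^2 k (1 - k^2) = - c^2 k^3, so
k = 0, whereas k = 0 makes X singular at t = 0.
*)

(** * Real polynomials that vanish identically *)

Lemma cubic_coef_eq0 (F : realFieldType) (a b c d : F) :
  (forall t, a * t ^+ 3 + b * t ^+ 2 + c * t + d = 0) ->
  [/\ a = 0, b = 0, c = 0 & d = 0].
Proof.
by move=> h; move: (h 0) (h 1) (h (-1)) (h 2) => h0 h1 h2 h3; split; lra.
Qed.

Lemma sextic_coef_eq0 (F : realFieldType) (c6 c5 c4 c3 c2 c1 c0 : F) :
  (forall t, c6 * t ^+ 6 + c5 * t ^+ 5 + c4 * t ^+ 4 + c3 * t ^+ 3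
             + c2 * t ^+ 2 + c1 * t + c0 = 0) ->
  [/\ c6 = 0, c5 = 0, c4 = 0 & c3 = 0] /\ [/\ c2 = 0, c1 = 0 & c0 = 0].
Proof.
move=> h; move: (h 0) (h 1) (h (-1)) (h 2) (h (-2)) (h 3) (h (-3)).
by move=> h0 h1 h2 h3 h4 h5 h6; split; split; lra.
Qed.

(** The substitution t = x - B / C turns the quadratic into C (x^2 + d) with
    d > 0.  The right-hand side is then even in x with all even coefficients
    proportional to mu.  If mu <> 0, the leading and constant coefficients r3 and
    s0 of the shifted cubic are nonzero; the absent x^5 term forces s2 = 0, and
    then 2 r3 s0 is a nonzero x^3 coefficient on the left.  Having no real root
    is essential: the cube of a squared linear form is a square. *)
Lemma cubic_sqr_eq_cube (F : realFieldType) (mu A B C r3 r2 r1 r0 : F) :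
  0 < C -> (forall t, 0 < C * t ^+ 2 + 2 * B * t + A) ->
  (forall t, (r3 * t ^+ 3 + r2 * t ^+ 2 + r1 * t + r0) ^+ 2
             = mu * (C * t ^+ 2 + 2 * B * t + A) ^+ 3) ->
  forall t, r3 * t ^+ 3 + r2 * t ^+ 2 + r1 * t + r0 = 0.
Proof.
move=> C0 Qpos cubE.
have Cn0 : C != 0 by rewrite gt_eqF.
pose h := B / C.
have BE : B = C * h by rewrite /h mulrC divfK.
pose d := A / C - h ^+ 2.
have AE : A = C * (d + h ^+ 2) by rewrite /d subrK mulrC divfK.
have d0 : 0 < d.
  rewrite -(pmulr_rgt0 _ C0); move: (Qpos (- h)); rewrite BE AE.
  by congr (0 < _); ring.
(* s2, s1, s0 are the lower coefficients of the shifted cubic. *)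
pose s2 := r2 - 3 * h * r3.
pose s1 := r1 - 2 * h * r2 + 3 * h ^+ 2 * r3.
pose s0 := r0 - h * r1 + h ^+ 2 * r2 - h ^+ 3 * r3.
pose nu := mu * C ^+ 3.
have key x : (r3 * x ^+ 3 + s2 * x ^+ 2 + s1 * x + s0) ^+ 2
             = nu * (x ^+ 2 + d) ^+ 3.
  have -> : nu * (x ^+ 2 + d) ^+ 3 =
     mu * (C * (x - h) ^+ 2 + 2 * B * (x - h) + A) ^+ 3.
    by rewrite BE AE /nu; ring.
  by rewrite -cubE; congr (_ ^+ 2); rewrite /s2 /s1 /s0; ring.
have [|[e6 e5 e4 e3] [e2 e1 e0]] :=
  @sextic_coef_eq0 _ (r3 ^+ 2 - nu) (2 * r3 * s2) (s2 ^+ 2 + 2 * r3 * s1 - 3 * nu * d)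
    (2 * r3 * s0 + 2 * s2 * s1) (s1 ^+ 2 + 2 * s2 * s0 - 3 * nu * d ^+ 2)
    (2 * s1 * s0) (s0 ^+ 2 - nu * d ^+ 3).
  by move=> t; have /eqP := key t; rewrite -subr_eq0 => /eqP <-; ring.
have nu0 : nu = 0.
  have [//|nun0] := eqVneq nu 0.
  have r30 : r3 != 0.
    by apply: contra_neq nun0 => r30; move: e6; rewrite r30; lra.
  have s00 : s0 != 0.
    apply: contra_neq nun0 => s00; move: e0; rewrite s00 expr0n /= sub0r => /eqP.
    by rewrite oppr_eq0 mulf_eq0 expf_eq0 /= (gt_eqF d0) orbF => /eqP.
  have s20 : s2 = 0.
    by move/eqP : e5; rewrite !mulf_eq0 pnatr_eq0 /= (negPf r30) => /eqP.
  move/eqP : e3; rewrite s20 mulr0 mul0r addr0 !mulf_eq0 pnatr_eq0 /=.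
  by rewrite (negPf r30) (negPf s00).
move=> t; have := key (t + h); rewrite nu0 mul0r => /eqP.
by rewrite sqrf_eq0 => /eqP <-; rewrite /s2 /s1 /s0; ring.
Qed.

(** * Algebra of triple products in 3-space *)

Section VectorAlgebra.
Variable R : realType.
Implicit Types (u v w x y z : 'rV[R]_3) (k : R).

(** The indices are taken in the cyclic group of order 3, so the sign pattern of
    the cross product needs no case distinction. *)
Definition cross u v : 'rV[R]_3 :=
  \row_i (u 0 (i + 1) * v 0 (i + 2) - u 0 (i + 2) * v 0 (i + 1)).

Definition triple u v w : R := dot u (cross v w).

Lemma dotE u v : dot u v = u 0 0 * v 0 0 + u 0 1 * v 0 1 + u 0 2 * v 0 2.
Proof.
rewrite /dot !big_ord_recr big_ord0 /= add0r.
by congr (_ * _ + _ * _ + _ * _); congr (_ 0 _); apply/val_inj.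
Qed.

Lemma crossE u v : [/\ cross u v 0 0 = u 0 1 * v 0 2 - u 0 2 * v 0 1,
  cross u v 0 1 = u 0 2 * v 0 0 - u 0 0 * v 0 2 &
  cross u v 0 2 = u 0 0 * v 0 1 - u 0 1 * v 0 0].
Proof.
by rewrite !mxE; split; congr (_ * _ - _ * _); congr (_ 0 _); apply/val_inj.
Qed.

Lemma row3P u v : u 0 0 = v 0 0 -> u 0 1 = v 0 1 -> u 0 2 = v 0 2 -> u = v.
Proof.
move=> h0 h1 h2; apply/rowP => -[[|[|[|//]]] i].
- by rewrite (_ : Ordinal i = 0) //; exact/val_inj.
- by rewrite (_ : Ordinal i = 1) //; exact/val_inj.
- by rewrite (_ : Ordinal i = 2) //; exact/val_inj.
Qed.

Lemma tripleE u v w : triple u v w =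
    u 0 0 * (v 0 1 * w 0 2 - v 0 2 * w 0 1)
  + u 0 1 * (v 0 2 * w 0 0 - v 0 0 * w 0 2)
  + u 0 2 * (v 0 0 * w 0 1 - v 0 1 * w 0 0).
Proof. by rewrite /triple dotE; have [-> -> ->] := crossE v w. Qed.

Lemma dotC u v : dot u v = dot v u.
Proof. by rewrite !dotE; ring. Qed.

Lemma dotDl u v w : dot (u + v) w = dot u w + dot v w.
Proof. by rewrite !dotE !mxE; ring. Qed.

Lemma dotZl k u v : dot (k *: u) v = k * dot u v.
Proof. by rewrite !dotE !mxE; ring. Qed.

Lemma dotDr u v w : dot u (v + w) = dot u v + dot u w.
Proof. by rewrite !dotE !mxE; ring. Qed.

Lemma dotZr k u v : dot u (k *: v) = k * dot u v.
Proof. by rewrite !dotE !mxE; ring. Qed.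

Lemma dotNl u v : dot (- u) v = - dot u v.
Proof. by rewrite !dotE !mxE; ring. Qed.

Lemma dotNr u v : dot u (- v) = - dot u v.
Proof. by rewrite !dotE !mxE; ring. Qed.

Lemma tripleDl u u' v w : triple (u + u') v w = triple u v w + triple u' v w.
Proof. by rewrite !tripleE !mxE; ring. Qed.

Lemma tripleZl k u v w : triple (k *: u) v w = k * triple u v w.
Proof. by rewrite !tripleE !mxE; ring. Qed.

Lemma tripleDr u v w w' : triple u v (w + w') = triple u v w + triple u v w'.
Proof. by rewrite !tripleE !mxE; ring. Qed.

Lemma tripleZr k u v w : triple u v (k *: w) = k * triple u v w.
Proof. by rewrite !tripleE !mxE; ring. Qed.

Lemma triple_rotate u v w : triple u v w = triple v w u.
Proof. by rewrite !tripleE; ring. Qed.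

Lemma triple_swap u v w : triple u v w = - triple w v u.
Proof. by rewrite !tripleE; ring. Qed.

Lemma triple_id u v : triple u v u = 0.
Proof. by rewrite !tripleE; ring. Qed.

Lemma dot_ge0 u : 0 <= dot u u.
Proof. by rewrite dotE -!expr2 !addr_ge0 ?sqr_ge0. Qed.

Lemma dot_eq0 u : dot u u = 0 -> u = 0.
Proof.
rewrite dotE -!expr2 => /eqP.
rewrite !paddr_eq0 ?addr_ge0 ?sqr_ge0 // !sqrf_eq0 => /andP[/andP[h0 h1] h2].
by apply: row3P; rewrite mxE; exact/eqP.
Qed.

(** The product of two determinants is the determinant of the matrix of mutual
    dot products.  This is how all products of triple products are expressed by
    dot products below, without choosing a frame. *)
Lemma triple_gram u v w x y z : triple u v w * triple x y z =
    dot u x * (dot v y * dot w z - dot v z * dot w y)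
  - dot u y * (dot v x * dot w z - dot v z * dot w x)
  + dot u z * (dot v x * dot w y - dot v y * dot w x).
Proof. by rewrite !tripleE !dotE; ring. Qed.

(** The expansion of u in the basis v, w, v x w, multiplied by |v x w|^2 so that
    it remains true when v and w are dependent. *)
Lemma cross_basis u v w :
  (dot v v * dot w w - dot v w ^+ 2) *: u =
    (dot u v * dot w w - dot u w * dot v w) *: v
  + (dot u w * dot v v - dot u v * dot v w) *: w
  + triple u v w *: cross v w.
Proof.
rewrite tripleE !dotE; have [] := crossE v w; move: (cross v w) => n n0 n1 n2.
by apply: row3P; rewrite !mxE ?n0 ?n1 ?n2; ring.
Qed.

Lemma triple0_decomp u v w : dot v v = 1 -> dot v w = 0 -> triple u v w = 0 ->
  dot w w *: u = (dot u v * dot w w) *: v + dot u w *: w.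
Proof.
move=> vv vw uvw; have := cross_basis u v w.
by rewrite vv vw uvw scale0r addr0 !(mul1r, mulr1, expr0n, mulr0, subr0).
Qed.

Lemma triple0_scale u v w x : dot v v = 1 -> dot v w = 0 -> triple u v w = 0 ->
  dot w w * triple u v x = dot u w * triple w v x.
Proof.
move=> vv vw uvw; rewrite -tripleZl (triple0_decomp vv vw uvw) tripleDl !tripleZl.
by have -> : triple v v x = 0; [rewrite tripleE; ring|ring].
Qed.

(** With g1, b1, b2 the derivatives of g, b0, b1, the sum of triple products
    that is assumed to vanish is the derivative of [triple g b0 b1]. *)
Lemma triple0_derive g g1 b0 b1 b2 : dot b0 b0 = 1 -> dot b0 b1 = 0 ->
  triple g b0 b1 = 0 -> triple g1 b0 b1 + triple g b0 b2 = 0 ->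
  dot b1 b1 * triple g1 b0 b1 = dot g b1 * triple b0 b1 b2.
Proof.
move=> b00 b01 T T'; have := triple0_scale b2 b00 b01 T.
have -> : triple b1 b0 b2 = - triple b0 b1 b2 by rewrite !tripleE; ring.
have -> : triple g1 b0 b1 = - triple g b0 b2 by apply/eqP; rewrite -addr_eq0 T'.
by move=> gE; rewrite mulrN gE; ring.
Qed.

(** The 2-jet of the directrix and the 3-jet of the direction at one point are
    overdetermined.  The hypotheses on dot products of the b's come from
    |b0|^2 = 1; those on triple products are [triple g b0 b1] = 0, its derivative,
    and regularity; then follow the relation C + alpha p^2 = 0, half its first
    two derivatives, and the curvature equation at the parameter tau, for which
    v = X_s is orthogonal to b1.  At that parameter X_ss = g2 + tau b2 enters
    only through its b1-component, and <g2, b1> is what the second derivative of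
    the relation determines. *)
Lemma ruled_jet_contradiction (alpha : R) (g g1 g2 b0 b1 b2 b3 : 'rV[R]_3) :
  let C := dot b1 b1 in let r := dot b1 b2 in
  let p := dot g b1 in
  let p' := dot g1 b1 + dot g b2 in
  let p'' := dot g2 b1 + 2 * dot g1 b2 + dot g b3 in
  let tau := - dot g1 b1 / C in
  let v := g1 + tau *: b1 in
  C != 0 ->
  dot b0 b0 = 1 -> dot b0 b1 = 0 -> dot b0 b2 = - C -> dot b0 b3 = - 3 * r ->
  triple g b0 b1 = 0 -> triple g1 b0 b1 + triple g b0 b2 = 0 ->
  triple g1 b0 b1 != 0 ->
  C + alpha * p ^+ 2 = 0 ->
  r + alpha * p * p' = 0 ->
  dot b2 b2 + dot b1 b3 + alpha * (p' ^+ 2 + p * p'') = 0 ->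
  triple v b0 (g2 + tau *: b2) - 2 * dot v b0 * triple v b0 b1 =
    alpha * (dot v v - dot v b0 ^+ 2) * triple v b0 g ->
  False.
Proof.
move=> C r p p' p'' tau v C0 b00 b01 b02 b03 T T' d0 E0 E1 E2 PE.
have p0 : p != 0.
  by apply: contra_neq C0 => p0; move: E0; rewrite p0 expr0n mulr0 addr0.
have ap2 : alpha * p ^+ 2 = - C by move/eqP: E0; rewrite addrC addr_eq0 => /eqP.
set d := triple g1 b0 b1 in T' d0.
set D := triple b0 b1 b2.
set w := g2 + tau *: b2 in PE.
set a := dot g b0; set F := dot g1 b0.
have gE : C *: g = (a * C) *: b0 + p *: b1 by exact: triple0_decomp.
have e1 : C * dot g b2 = - (a * C ^+ 2) + p * r.
  by rewrite -dotZl gE dotDl !dotZl b02; rewrite /r; ring.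
have e2 : C * dot g b3 = - (3 * a * C * r) + p * dot b1 b3.
  by rewrite -dotZl gE dotDl !dotZl b03; ring.
have e3 : C * d = p * D by exact: triple0_derive T T'.
have tauE : tau * C = - dot g1 b1 by rewrite divfK.
have vb1 : dot v b1 = 0 by rewrite dotDl dotZl -/C tauE subrr.
have vb0 : dot v b0 = F by rewrite dotDl dotZl (dotC b1) b01 mulr0 addr0.
have vd : triple v b0 b1 = d.
  by rewrite tripleDl tripleZl triple_id mulr0 addr0.
rewrite vb0 in PE; set Q := dot v v - F ^+ 2 in PE.
(* Gram identities; note that Q = |v x b0|^2. *)
have e4 : d * D = C * dot g1 b2 + F * C ^+ 2 - dot g1 b1 * r.
  rewrite /D -[triple b0 b1 b2]triple_rotate -triple_rotate /d triple_gram.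
  by rewrite (dotC b1 b0) b00 b01 b02 -/C -/r -/F; ring.
have e5 : D ^+ 2 = C * dot b2 b2 - C ^+ 3 - r ^+ 2.
  rewrite expr2 /D triple_gram (dotC b1 b0) (dotC b2 b0) (dotC b2 b1).
  by rewrite b00 b01 b02 -/C -/r; ring.
have e6 : d ^+ 2 = C * Q.
  rewrite expr2 -vd triple_gram (dotC b0 v) (dotC b1 v) (dotC b1 b0).
  by rewrite b00 b01 vb1 vb0 -/C /Q; ring.
have e7 : d * triple v b0 w = dot b1 w * Q.
  rewrite -vd triple_gram (dotC b1 v) (dotC b0 v) (dotC b1 b0).
  by rewrite b00 b01 vb1 vb0 /Q; ring.
have e8 : C * triple v b0 g = p * d.
  by rewrite triple_swap mulrN triple0_scale // -/p -vd (triple_swap b1); ring.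
have Q0 : Q != 0.
  by apply: contra_neq d0 => Q0; apply/eqP; rewrite -sqrf_eq0 e6 Q0 mulr0.
rewrite vd in PE.
have w1 : dot b1 w = dot g2 b1 + tau * r by rewrite dotDr dotZr (dotC b1 g2).
(* The curvature equation at tau, multiplied by d and freed from alpha by
   alpha p^2 = - C. *)
have PE1 : p * (dot b1 w - 2 * F * C) = - d ^+ 2.
  apply: (mulfI (mulf_neq0 C0 Q0)).
  have -> : C * Q * (p * (dot b1 w - 2 * F * C))
      = p * C * (dot b1 w * Q) - 2 * F * p * C * (C * Q) by ring.
  rewrite -e7 -e6.
  have -> : p * C * (d * triple v b0 w) - 2 * F * p * C * d ^+ 2
      = p * C * d * (triple v b0 w - 2 * F * d) by ring.
  rewrite PE.
  have -> : p * C * d * (alpha * Q * triple v b0 g)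
      = alpha * p * Q * d * (C * triple v b0 g) by ring.
  by rewrite e8; have -> : alpha * p * Q * d * (p * d)
      = alpha * p ^+ 2 * Q * d ^+ 2; [ring|rewrite ap2 e6; ring].
(* First derivative of the relation; it also identifies tau. *)
have p'E : C * p' = r * p.
  have : p * (r + alpha * p * p') = 0 by rewrite E1 mulr0.
  have -> : p * (r + alpha * p * p') = r * p + alpha * p ^+ 2 * p' by ring.
  by rewrite ap2; lra.
have tau_a : tau = - a.
  apply: (mulfI (expf_neq0 2 C0)).
  have -> : C ^+ 2 * tau = C * (tau * C) by ring.
  by rewrite tauE; move: p'E; rewrite /p' mulrDr e1; lra.
have d2E : d ^+ 2 = p * dot g1 b2 + p * F * C - p * a * r.
  apply: (mulfI C0).
  have -> : C * d ^+ 2 = d * (p * D) by rewrite -e3; ring.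
  have -> : d * (p * D) = p * (d * D) by ring.
  have q1E : dot g1 b1 = a * C by apply: oppr_inj; rewrite -tauE tau_a; ring.
  by rewrite e4 q1E; ring.
have C2d2 : C ^+ 2 * d ^+ 2 = p ^+ 2 * (C * dot b2 b2 - C ^+ 3 - r ^+ 2).
  by rewrite -e5 -!exprMn e3.
(* Second derivative of the relation, freed from alpha. *)
have Sm : C * p ^+ 2 * (dot b2 b2 + dot b1 b3) = r ^+ 2 * p ^+ 2 + C ^+ 2 * p * p''.
  apply: (mulfI C0).
  have -> : C * (r ^+ 2 * p ^+ 2 + C ^+ 2 * p * p'') = C * (C * p') ^+ 2 + C ^+ 3 * (p * p'').
    by rewrite p'E; ring.
  have : C ^+ 2 * p ^+ 2 *
     (dot b2 b2 + dot b1 b3 + alpha * (p' ^+ 2 + p * p'')) = 0 by rewrite E2 mulr0.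
  have -> : C ^+ 2 * p ^+ 2 *
     (dot b2 b2 + dot b1 b3 + alpha * (p' ^+ 2 + p * p''))
     = C ^+ 2 * p ^+ 2 * (dot b2 b2 + dot b1 b3)
       + alpha * p ^+ 2 * C ^+ 2 * (p' ^+ 2 + p * p'') by ring.
  by rewrite ap2; lra.
have p''E : C * p'' = C * dot g2 b1 + 2 * (C * dot g1 b2)
    - 3 * a * C * r + p * dot b1 b3.
  by rewrite /p'' !mulrDr e2; ring.
have yE : p * dot g2 b1 = a * r * p + 2 * F * C * p - d ^+ 2.
  by move: PE1; rewrite w1 tau_a; lra.
have : p ^+ 2 * C = 0.
  apply: (mulfI (expf_neq0 2 C0)).
  have : C ^+ 2 * p * p'' = C * p * (C * p'') by ring.
  have : C ^+ 2 * (p * dot g2 b1) = C ^+ 2 * (a * r * p + 2 * F * C * p - d ^+ 2).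
    by rewrite yE.
  have : C ^+ 2 * d ^+ 2 = C ^+ 2 * (p * dot g1 b2 + p * F * C - p * a * r).
    by rewrite d2E.
  by rewrite p''E; move: C2d2 Sm; lra.
by move/eqP; rewrite mulf_eq0 sqrf_eq0 (negPf p0) (negPf C0).
Qed.

End VectorAlgebra.

(** * Derivatives along a curve *)

Section Calculus.
Variable R : realType.
Implicit Types (f g : R^o -> 'rV[R]_3) (s : R^o) (A : set R^o).

(** The k-th derivative, written as an iterated directional derivative so that
    smoothness applies to it verbatim. *)
Definition jet f (k : nat) : R^o -> 'rV[R]_3 := iter_derive (nseq k (1 : R^o)) f.

Lemma is_derive_jet A f k s : smooth_on A f -> A s ->
  is_derive s (1 : R^o) (jet f k) (jet f k.+1 s).
Proof. by move=> sf As; exact/derivableP/diff_derivable/sf. Qed.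

Lemma is_derive_coord f s (df : 'rV[R]_3) i : is_derive s (1 : R^o) f df ->
  is_derive s (1 : R^o) (fun x => f x 0 i : R^o) (df 0 i).
Proof.
move=> [fs <-]; apply: DeriveDef; first by move/derivable_mxP : fs; exact.
by rewrite derive_mx // mxE.
Qed.

Lemma is_derive_dot f g s (df dg : 'rV[R]_3) :
  is_derive s (1 : R^o) f df -> is_derive s (1 : R^o) g dg ->
  is_derive s (1 : R^o) (fun x => dot (f x) (g x) : R^o)
    (dot df (g s) + dot (f s) dg).
Proof.
move=> hf hg.
have hfi i := is_derive_coord i hf; have hgi i := is_derive_coord i hg.
under eq_fun do rewrite dotE.
apply: is_derive_eq.
by rewrite !dotE /GRing.scale /=; ring.
Qed.

Lemma is_derive_triple f g h s (df dg dh : 'rV[R]_3) :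
  is_derive s (1 : R^o) f df -> is_derive s (1 : R^o) g dg ->
  is_derive s (1 : R^o) h dh ->
  is_derive s (1 : R^o) (fun x => triple (f x) (g x) (h x) : R^o)
    (triple df (g s) (h s) + triple (f s) dg (h s) + triple (f s) (g s) dh).
Proof.
move=> hf hg hh.
have hfi i := is_derive_coord i hf; have hgi i := is_derive_coord i hg.
have hhi i := is_derive_coord i hh.
under eq_fun do rewrite tripleE.
apply: is_derive_eq.
by rewrite !tripleE /GRing.scale /=; ring.
Qed.

Lemma is_derive_cst_on (A : set R^o) (f : R^o -> R^o) s (c df : R) :
  is_derive s (1 : R^o) f df -> open A -> A s -> (forall x, A x -> f x = c) ->
  df = 0.
Proof.
move=> fdf oA As fc.
have fnc : \forall x \near s, f x = cst c x.
  by apply: filterS (open_nbhs_nbhs (conj oA As)) => x; exact: fc.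
by have [_ <-] := near_eq_is_derive fnc fdf; rewrite derive_cst.
Qed.

Lemma interval_derive0_cst (I : set R) (f : R^o -> R^o) :
  is_interval I -> (forall x, I x -> is_derive (x : R^o) (1 : R^o) f 0) ->
  forall x y, I x -> I y -> f x = f y.
Proof.
move=> itvI f0.
suff lef x y : I x -> I y -> x < y -> f x = f y.
  move=> x y Ix Iy; have [xy|yx|-> //] := ltgtP x y; first exact: lef.
  by apply/esym; exact: lef.
move=> Ix Iy xy.
have Iz z : z \in `[x, y] -> I z.
  by rewrite in_itv /=; exact: itvI.
have [] := @MVT R f (cst 0) x y xy.
- by move=> z zxy; apply/f0/Iz; exact: subset_itv_oo_cc.
- by apply: derivable_within_continuous => z zxy; have [] := f0 _ (Iz _ zxy).
by move=> c _ /eqP; rewrite mul0r subr_eq0 => /eqP.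
Qed.

End Calculus.

(** * Partial derivatives of a ruled map *)

Section RuledMap.
Variable R : realType.
Implicit Types (g b : R^o -> 'rV[R]_3) (u : 'rV[R]_2).

(** Reduces a partial derivative to the derivative of a curve, here without
    differentiability of f: the two difference quotients are the same function. *)
Lemma partial_curve (i : 'I_2) (f : 'rV[R]_2 -> 'rV[R]_3) (h : R^o -> 'rV[R]_3) u :
  (forall t : R, f (t *: delta_mx 0 i + u) = h (t + u 0 i)) ->
  partial i f u = 'D_(1 : R^o) h (u 0 i : R^o).
Proof.
move=> fh; rewrite /partial /derive.
set q := fun t : R => t^-1 *: ((f \o shift u) (t *: delta_mx 0 i) - f u).
set q' := fun t : R => _.
suff -> : q = q' by [].
apply/funext => t; rewrite /q /q' /= fh; have := fh 0; rewrite scale0r !add0r => ->.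
by rewrite /GRing.scale /= mulr1.
Qed.

Lemma partial0_ruled g b u : derivable g (u 0 0 : R^o) 1 -> derivable b (u 0 0 : R^o) 1 ->
  partial 0 (ruled_map g b) u = ruled_map (jet g 1) (jet b 1) u.
Proof.
move=> dg db.
rewrite (@partial_curve _ _ (g + u 0 1 \*: b)).
  by rewrite (derive_val (is_derive := is_deriveD (derivableP dg)
    (is_deriveZ (u 0 1) (derivableP db)))).
by move=> t; rewrite /ruled_map !mxE /= mulr1 mulr0 add0r.
Qed.

Lemma partial1_ruled g b u : partial 1 (ruled_map g b) u = b (u 0 0).
Proof.
have lin : is_diff (u 0 1 : R^o) ( *:%R^~ (b (u 0 0))) ( *:%R^~ (b (u 0 0))).
  exact: is_diff_scalel.
rewrite (@partial_curve _ _ (cst (g (u 0 0)) + ( *:%R^~ (b (u 0 0))))).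
  rewrite deriveD ?derive_cst ?add0r //; last exact/diff_derivable/ex_diff.
  by rewrite deriveE ?diff_val ?scale1r //; exact: ex_diff.
by move=> t; rewrite /ruled_map !mxE /= mulr1 mulr0 add0r.
Qed.

Lemma open_strip (I : set R) : open I -> open [set u : 'rV[R]_2 | I (u 0 0)].
Proof.
by move=> oI; apply: (open_comp _ oI) => u _; exact: coord_continuous.
Qed.

Lemma partial_near i (f h : 'rV[R]_2 -> 'rV[R]_3) u (A : set 'rV[R]_2) :
  open A -> A u -> (forall v, A v -> f v = h v) -> partial i f u = partial i h u.
Proof.
move=> oA Au fh; apply: near_eq_derive.
by apply: filterS (open_nbhs_nbhs (conj oA Au)) => v; exact: fh.
Qed.

Section SmoothRuled.
Variables (I : set R) (g b : R^o -> 'rV[R]_3).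
Hypotheses (oI : open I) (sg : smooth_on (I : set R^o) g)
  (sb : smooth_on (I : set R^o) b).

Let djet f k s : smooth_on (I : set R^o) f -> I s -> derivable (jet f k) (s : R^o) 1.
Proof. by move=> sf Is; have [] := is_derive_jet k sf Is. Qed.

Lemma partial0_smooth u : I (u 0 0) ->
  partial 0 (ruled_map g b) u = ruled_map (jet g 1) (jet b 1) u.
Proof.
move=> Iu; apply: partial0_ruled.
- exact: (@djet g 0 _ sg Iu).
- exact: (@djet b 0 _ sb Iu).
Qed.

Lemma partial00_ruled u : I (u 0 0) ->
  partial 0 (partial 0 (ruled_map g b)) u = ruled_map (jet g 2) (jet b 2) u.
Proof.
move=> Iu; rewrite (partial_near _ (open_strip oI) Iu partial0_smooth).
apply: partial0_ruled.
- exact: (@djet g 1 _ sg Iu).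
- exact: (@djet b 1 _ sb Iu).
Qed.

Lemma partial10_ruled u : I (u 0 0) ->
  partial 1 (partial 0 (ruled_map g b)) u = jet b 1 (u 0 0).
Proof.
move=> Iu; rewrite (partial_near _ (open_strip oI) Iu partial0_smooth).
exact: partial1_ruled.
Qed.

(** The t-derivative of a ruled map is again a ruled map, with directrix b and
    null direction, so the lemmas above apply to it. *)
Let partial1_ruledE : partial 1 (ruled_map g b) = ruled_map b (cst 0).
Proof. by apply/funext => u; rewrite partial1_ruled /ruled_map scaler0 addr0. Qed.

Lemma partial01_ruled u : I (u 0 0) ->
  partial 0 (partial 1 (ruled_map g b)) u = jet b 1 (u 0 0).
Proof.
move=> Iu; rewrite partial1_ruledE partial0_ruled; [|exact: (@djet b 0 _ sb Iu)|by []].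
by rewrite /ruled_map [jet (cst 0) 1 _]derive_cst scaler0 addr0.
Qed.

Lemma partial11_ruled u : partial 1 (partial 1 (ruled_map g b)) u = 0.
Proof. by rewrite partial1_ruledE partial1_ruled. Qed.

End SmoothRuled.

End RuledMap.

(** * The mean curvature equation along a ruling *)

Section Geometry.
Variable R : realType.
Implicit Types (u v w x n : 'rV[R]_3).

Lemma sum_ord2 (F : 'I_2 -> R) : \sum_i F i = F 0 + F 1.
Proof.
by rewrite big_ord_recl big_ord1; congr (_ + F _); exact/val_inj.
Qed.

Lemma trace_invmx2 (A B : 'M[R]_2) : let d := A 0 0 * A 1 1 - A 0 1 * A 1 0 in
  d != 0 ->
  d * \tr (invmx A *m B) =
    A 1 1 * B 0 0 - A 0 1 * B 1 0 - A 1 0 * B 0 1 + A 0 0 * B 1 1.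
Proof.
move=> d d0.
have dE : \det A = d.
  rewrite (expand_det_row _ 0) sum_ord2 /cofactor !det_mx11 !mxE /=.
  have -> : lift 0 0 = 1 :> 'I_2 by exact/val_inj.
  have -> : lift 1 0 = 0 :> 'I_2 by exact/val_inj.
  by rewrite addn0 modn_small // add0n expr0 expr1 /d; ring.
have Au : A \in unitmx by rewrite unitmxE dE unitfE.
set S := invmx A *m B.
have -> : B = A *m S by rewrite mulKVmx.
by rewrite /mxtrace !mxE !sum_ord2 /d; ring.
Qed.

Lemma normal_triple u v n : dot n n = 1 -> dot n u = 0 -> dot n v = 0 ->
  triple u v n ^+ 2 = dot u u * dot v v - dot u v ^+ 2.
Proof.
move=> nn nu nv; rewrite expr2 triple_gram (dotC u n) (dotC v n) (dotC v u).
by rewrite nn nu nv; ring.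
Qed.

(** [triple u v n] is +- the area of the parallelogram on u and v; multiplying by
    it turns components along the normal into determinants, whatever the
    orientation of n. *)
Lemma normal_dot u v n w : dot n n = 1 -> dot n u = 0 -> dot n v = 0 ->
  triple u v n != 0 -> triple u v n * dot n w = triple u v w.
Proof.
move=> nn nu nv T0; apply: (mulfI T0).
rewrite mulrA -expr2 triple_gram nu nv.
by rewrite normal_triple // (dotC v u); ring.
Qed.

(** The trace formula for H multiplied by rho = det(Xs, Xt, n), where rho^2 = Q.
    Squaring removes the sign of rho, which the Gauss map leaves open. *)
Lemma mean_curvature_eq alpha lambda (Xs Xt Xss Xst x n : 'rV[R]_3)
    (I1 I2 : 'M[R]_2) :
  let Q := dot Xs Xs - dot Xs Xt ^+ 2 in
  dot Xt Xt = 1 -> dot n n = 1 -> dot n Xs = 0 -> dot n Xt = 0 -> Q != 0 ->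
  I1 0 0 = dot Xs Xs -> I1 0 1 = dot Xs Xt -> I1 1 0 = dot Xt Xs ->
  I1 1 1 = dot Xt Xt ->
  I2 0 0 = dot Xss n -> I2 0 1 = dot Xst n -> I2 1 0 = dot Xst n -> I2 1 1 = 0 ->
  alpha * dot n x + lambda = \tr (invmx I1 *m I2) ->
  (triple Xs Xt Xss - 2 * dot Xs Xt * triple Xs Xt Xst
     - alpha * Q * triple Xs Xt x) ^+ 2 = lambda ^+ 2 * Q ^+ 3.
Proof.
move=> Q tt nn ns nt Q0 E00 E01 E10 E11 F00 F01 F10 F11 HE.
have dQ : I1 0 0 * I1 1 1 - I1 0 1 * I1 1 0 = Q.
  by rewrite E00 E01 E10 E11 tt (dotC Xt Xs) /Q; ring.
have := @trace_invmx2 I1 I2; rewrite /= dQ -HE => /(_ Q0).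
rewrite E00 E01 E10 E11 F00 F01 F10 F11 tt (dotC Xt Xs) !(dotC _ n) => QH.
set rho := triple Xs Xt n.
have rho2 : rho ^+ 2 = Q by rewrite normal_triple // tt mulr1.
have rho0 : rho != 0 by apply: contra_neq Q0 => r0; rewrite -rho2 r0 expr0n.
have TE w : triple Xs Xt w = rho * dot n w by rewrite normal_dot.
rewrite !TE.
have -> : rho * dot n Xss - 2 * dot Xs Xt * (rho * dot n Xst)
    - alpha * Q * (rho * dot n x) = lambda * rho * Q.
  have -> : lambda * rho * Q
      = rho * (Q * (alpha * dot n x + lambda)) - alpha * Q * (rho * dot n x) by ring.
  by rewrite QH; ring.
by rewrite !exprMn rho2; ring.
Qed.

(** The rows of the Jacobian are the partial derivatives. *)
Lemma row_free_jacobian (X : 'rV[R]_2 -> 'rV[R]_3) (u : 'rV[R]_2) :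
  differentiable X u -> row_free ('J X u) ->
  forall a b : R, a *: partial 0 X u + b *: partial 1 X u = 0 -> a = 0.
Proof.
move=> dX fJ a b; rewrite /partial !deriveEjacobian // !scalemxAl -mulmxDl.
move/eqP; rewrite mulmx_free_eq0 // => /eqP /matrixP /(_ 0 0).
by rewrite !mxE /= mulr1 mulr0 addr0.
Qed.

Lemma dot_reject v w : dot w w = 1 ->
  dot (v - dot v w *: w) (v - dot v w *: w) = dot v v - dot v w ^+ 2.
Proof.
move=> ww; rewrite dotDl !dotDr !(dotNl, dotNr, dotZl, dotZr) (dotC w v) ww.
by ring.
Qed.

Lemma enorm1 v : enorm v = 1 -> dot v v = 1.
Proof. by move=> v1; rewrite -(sqr_sqrtr (dot_ge0 v)) -/(enorm v) v1 expr1n. Qed.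

(** The determinant with the position vector g + t b in the last place is the one
    with g there, as b is already its second entry.  Positivity of
    Q = |X_s - F b|^2 is the linear independence of X_s and X_t. *)
Lemma ruled_self_similar_eq (alpha lambda : R) (M : set 'rV[R]_3)
    (N : 'rV[R]_3 -> 'rV[R]_3) (I : set R) (g b : R -> 'rV[R]_3) :
  gauss_map M N -> self_similar alpha lambda M N -> ruling M I g b ->
  forall s t, I s ->
    let v := jet g 1 s + t *: jet b 1 s in
    let F := dot v (b s) in
    let Q := dot v v - F ^+ 2 in
    0 < Q /\
    (triple v (b s) (jet g 2 s + t *: jet b 2 s) - 2 * F * triple v (b s) (jet b 1 s)
       - alpha * Q * triple v (b s) (g s)) ^+ 2 = lambda ^+ 2 * Q ^+ 3.
Proof.
move=> [N1 NX] HM [[oI _ _] [sg sb] b1 ME par] s t Is v F Q.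
pose u : 'rV[R]_2 := \row_i (if i == 0 then s else t).
have us : u 0 0 = s by rewrite mxE.
have ut : u 0 1 = t by rewrite mxE.
have Iu : I (u 0 0) by rewrite us.
have [V [Vu lV]] := par u Iu.
set X := ruled_map g b in lV.
have MX : M (X u) by rewrite ME; exists u.
have [_ NXu] := NX _ _ lV.
have X0 : partial 0 X u = v.
  by rewrite (partial0_smooth sg sb Iu) /ruled_map us ut.
have X1 : partial 1 X u = b s by rewrite partial1_ruled us.
have bb : dot (b s) (b s) = 1 by exact/enorm1/b1.
have [oV sX fJ _ _] := lV.
have Qpos : 0 < Q.
  have QE : Q = dot (v - F *: b s) (v - F *: b s) by rewrite dot_reject.
  rewrite QE lt_neqAle dot_ge0 andbT eq_sym; apply/eqP => /dot_eq0 v0.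
  have := row_free_jacobian (sX [::] u Vu) (fJ u Vu) (a := 1) (b := - F).
  by rewrite X0 X1 scale1r scaleNr v0 => /(_ erefl)/eqP; rewrite oner_eq0.
split=> //.
have NX1 := enorm1 (N1 _ MX).
have XE : X u = g s + t *: b s by rewrite /X /ruled_map us ut.
have -> : triple v (b s) (g s) = triple v (b s) (X u).
  by rewrite XE tripleDr tripleZr; have -> : triple v (b s) (b s) = 0;
    [rewrite tripleE; ring|ring].
apply: (@mean_curvature_eq _ _ _ _ _ _ _ (N (X u)) (first_form X u) (second_form N X u)) => //.
- by rewrite -X0; apply: NXu.
- by rewrite -X1; apply: NXu.
- by rewrite gt_eqF.
- by rewrite mxE X0.
- by rewrite mxE X0 X1.
- by rewrite mxE X0 X1.
- by rewrite mxE X1.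
- by rewrite mxE (partial00_ruled oI sg sb Iu) /ruled_map us ut.
- by rewrite mxE (partial01_ruled g sb Iu) us.
- by rewrite mxE (partial10_ruled oI sg sb Iu) us.
- by rewrite mxE partial11_ruled dotE !mxE; ring.
- exact: HM lV Vu _.
Qed.

End Geometry.

(** * Rigidity of the direction of the rulings *)

Section Rigidity.
Variable R : realType.

(** The first conclusion says that lambda drops out; the next two are the
    coefficients of t^3 and t^2 in P = alpha Q D.  For the last one: if g1 were in
    the span of b0 and b1, then v t would be parallel to b0 at the t making it
    orthogonal to b1, and Q would vanish there. *)
Lemma ruled_identity_coefs (alpha lambda : R) (g g1 g2 b0 b1 b2 : 'rV[R]_3) :
  let F := dot g1 b0 in
  let v t := g1 + t *: b1 in
  let Q t := dot (v t) (v t) - dot (v t) b0 ^+ 2 in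
  let P t := triple (v t) b0 (g2 + t *: b2)
             - 2 * dot (v t) b0 * triple (v t) b0 b1 in
  alpha != 0 -> dot b1 b1 != 0 -> dot b0 b0 = 1 -> dot b0 b1 = 0 ->
  (forall t, 0 < Q t /\
     (P t - alpha * Q t * triple (v t) b0 g) ^+ 2 = lambda ^+ 2 * Q t ^+ 3) ->
  [/\ forall t, P t = alpha * Q t * triple (v t) b0 g,
      triple g b0 b1 = 0,
      triple b1 b0 b2 = alpha * dot b1 b1 * triple g1 b0 g &
      triple g1 b0 b1 != 0].
Proof.
move=> F v Q P alpha0 C0 b00 b01 h.
have C_gt0 : 0 < dot b1 b1 by rewrite lt_neqAle eq_sym C0 dot_ge0.
have vF t : dot (v t) b0 = F.
  by rewrite /v dotDl dotZl (dotC b1) b01 mulr0 addr0.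
set C := dot b1 b1 in C0 C_gt0 *.
set q := dot g1 b1.
set A := dot g1 g1 - F ^+ 2.
have QE t : Q t = C * t ^+ 2 + 2 * q * t + A.
  rewrite /Q vF /v dotDl !dotDr !(dotZl, dotZr) (dotC b1 g1) -/C -/q /A.
  by ring.
set D1 := triple b1 b0 g; set D0 := triple g1 b0 g.
have DE t : triple (v t) b0 g = D1 * t + D0.
  by rewrite /v tripleDl tripleZl addrC mulrC.
set P2 := triple b1 b0 b2.
set P1 := triple g1 b0 b2 + triple b1 b0 g2.
set P0 := triple g1 b0 g2 - 2 * F * triple g1 b0 b1.
have PE t : P t = P2 * t ^+ 2 + P1 * t + P0.
  rewrite /P vF /v !tripleDl !tripleDr !(tripleZl, tripleZr) triple_id.
  by rewrite /P2 /P1 /P0; ring.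
pose r3 := - (alpha * C * D1).
pose r2 := P2 - alpha * (C * D0 + 2 * q * D1).
pose r1 := P1 - alpha * (2 * q * D0 + A * D1).
pose r0 := P0 - alpha * A * D0.
have RE t : P t - alpha * Q t * triple (v t) b0 g
    = r3 * t ^+ 3 + r2 * t ^+ 2 + r1 * t + r0.
  by rewrite PE QE DE /r3 /r2 /r1 /r0; ring.
have R0 : forall t, r3 * t ^+ 3 + r2 * t ^+ 2 + r1 * t + r0 = 0.
  apply: (@cubic_sqr_eq_cube _ (lambda ^+ 2) A q C) => //.
    by move=> t; rewrite -QE; case: (h t).
  by move=> t; rewrite -QE -RE; case: (h t).
have [r30 r20 _ _] := cubic_coef_eq0 R0.
have D10 : D1 = 0.
  by move/eqP: r30; rewrite oppr_eq0 !mulf_eq0 (negPf alpha0) (negPf C0) => /eqP.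
split.
- by move=> t; apply/eqP; rewrite -subr_eq0 RE R0.
- by rewrite triple_swap -/D1 D10 oppr0.
- by move: r20; rewrite /r2 D10; lra.
- apply/eqP => T0; pose t := - q / C.
  have tC : t * C = - q by rewrite divfK.
  have vb1 : dot (v t) b1 = 0 by rewrite dotDl dotZl -/C tC subrr.
  have : triple (v t) b0 b1 ^+ 2 = C * Q t.
    rewrite expr2 triple_gram (dotC b0 (v t)) (dotC b1 (v t)) (dotC b1 b0).
    by rewrite b00 b01 vb1 /Q -/C; ring.
  rewrite tripleDl tripleZl triple_id T0 mulr0 addr0 expr0n => /esym/eqP.
  by rewrite mulf_eq0 (negPf C0) gt_eqF //; case: (h t).
Qed.

(** As g lies in the plane of b0 and b1, the ruling g + R b0 is at distance
    |<g, b1>| / |b1| from the origin: the conclusion says that this distance is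
    1 / sqrt(- alpha), and in particular that alpha < 0. *)
Lemma origin_distance_eq (alpha : R) (g g1 b0 b1 b2 : 'rV[R]_3) :
  dot b1 b1 != 0 -> dot b0 b0 = 1 -> dot b0 b1 = 0 -> triple g b0 b1 = 0 ->
  triple g1 b0 b1 + triple g b0 b2 = 0 -> triple g1 b0 b1 != 0 ->
  triple b1 b0 b2 = alpha * dot b1 b1 * triple g1 b0 g ->
  dot b1 b1 + alpha * dot g b1 ^+ 2 = 0.
Proof.
move=> C0 b00 b01 T T' d0 PE.
have e1 := triple0_derive b00 b01 T T'.
have := triple0_scale g1 b00 b01 T.
rewrite (triple_swap g) (triple_swap b1 b0 g1) !mulrN => /oppr_inj.
set C := dot b1 b1 in C0 PE e1 *.
set p := dot g b1 in e1 *.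
set d := triple g1 b0 b1 in T' d0 e1 * => e2.
have e3 : triple b1 b0 b2 = - triple b0 b1 b2 by rewrite !tripleE; ring.
have e4 : - triple b0 b1 b2 = alpha * (p * d) by rewrite -e3 PE -e2; ring.
apply: (mulIf d0); rewrite mul0r.
have -> : (C + alpha * p ^+ 2) * d = C * d + p * (alpha * (p * d)) by ring.
by rewrite -e4 e1; ring.
Qed.

(** The derivatives of the curves are carried by the sequences g and b.  At a
    point where b 1 does not vanish, the relations of [ruled_identity_coefs] hold
    on the open set J of all such points, and there they may be differentiated. *)
Lemma direction_derive_eq0 (alpha lambda : R) (I : set R)
    (g b : nat -> R^o -> 'rV[R]_3) :
  alpha != 0 -> open I ->
  (forall k s, I s -> is_derive (s : R^o) (1 : R^o) (g k) (g k.+1 s)) ->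
  (forall k s, I s -> is_derive (s : R^o) (1 : R^o) (b k) (b k.+1 s)) ->
  (forall s, I s -> dot (b 0%N s) (b 0%N s) = 1) ->
  (forall s t, I s ->
    let v := g 1%N s + t *: b 1%N s in
    let F := dot v (b 0%N s) in
    let Q := dot v v - F ^+ 2 in
    0 < Q /\
    (triple v (b 0%N s) (g 2%N s + t *: b 2%N s) - 2 * F * triple v (b 0%N s) (b 1%N s)
       - alpha * Q * triple v (b 0%N s) (g 0%N s)) ^+ 2 = lambda ^+ 2 * Q ^+ 3) ->
  forall s, I s -> b 1%N s = 0.
Proof.
move=> alpha0 oI dg db b00 eqQ s0 Is0; apply/dot_eq0/eqP; apply/negP => /negP C0.
have b01 s : I s -> dot (b 0%N s) (b 1%N s) = 0.
  move=> Is.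
  have := is_derive_cst_on (is_derive_dot (db 0 s Is) (db 0 s Is)) oI Is b00.
  by rewrite (dotC (b 1%N s)); lra.
have b02 s : I s -> dot (b 1%N s) (b 1%N s) + dot (b 0%N s) (b 2%N s) = 0.
  move=> Is.
  exact: is_derive_cst_on (is_derive_dot (db 0 s Is) (db 1 s Is)) oI Is b01.
have b03 s : I s -> dot (b 0%N s) (b 3%N s) = - 3 * dot (b 1%N s) (b 2%N s).
  move=> Is.
  have := is_derive_cst_on (is_deriveD (is_derive_dot (db 1 s Is) (db 1 s Is))
    (is_derive_dot (db 0 s Is) (db 2 s Is))) oI Is b02.
  by rewrite (dotC (b 2%N s)); lra.
pose J : set R^o := [set s | I s /\ dot (b 1%N s) (b 1%N s) != 0].
have JI s : J s -> I s by case.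
have Js0 : J s0 by [].
have oJ : open J.
  rewrite openE => s [Is Cs]; rewrite /interior.
  have Cc : {for (s : R^o), continuous (fun x => dot (b 1 x) (b 1 x) : R^o)}.
    apply: differentiable_continuous; apply/derivable1_diffP.
    by have [] := is_derive_dot (db 1 s Is) (db 1 s Is).
  near=> x; split; last by near: x; exact: cvgr_neq0 Cc Cs.
  by near: x; exact: open_nbhs_nbhs (conj oI Is).
have key s (Js : J s) := ruled_identity_coefs (g2 := g 2%N s) (b2 := b 2%N s)
  alpha0 (proj2 Js) (b00 _ (JI _ Js)) (b01 _ (JI _ Js))
  (fun t => eqQ s t (JI _ Js)).
have T s : J s -> triple (g 0%N s) (b 0%N s) (b 1%N s) = 0.
  by move=> /key[].
have T' s : J s -> triple (g 1%N s) (b 0%N s) (b 1%N s)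
                 + triple (g 0%N s) (b 0%N s) (b 2%N s) = 0.
  move=> Js; have Is := JI _ Js.
  have := is_derive_cst_on (is_derive_triple (dg 0 s Is) (db 0 s Is) (db 1 s Is))
    oJ Js T.
  by have -> : triple (g 0%N s) (b 1%N s) (b 1%N s) = 0;
    [rewrite tripleE; ring|rewrite addr0].
have E s : J s -> dot (b 1%N s) (b 1%N s)
     + alpha * (dot (g 0%N s) (b 1%N s) * dot (g 0%N s) (b 1%N s)) = 0.
  move=> Js; have [_ Ts PE d0] := key s Js.
  rewrite -expr2; apply: origin_distance_eq (T' _ Js) d0 PE => //; first by case: Js.
  - exact/b00/JI.
  - exact/b01/JI.
have dp s (Js : J s) := is_derive_dot (dg 0 s (JI _ Js)) (db 1 s (JI _ Js)).
have dC s (Js : J s) := is_derive_dot (db 1 s (JI _ Js)) (db 1 s (JI _ Js)).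
have E1 s : J s -> dot (b 1%N s) (b 2%N s)
   + alpha * (dot (g 0%N s) (b 1%N s)
     * (dot (g 1%N s) (b 1%N s) + dot (g 0%N s) (b 2%N s))) = 0.
  move=> Js.
  have := is_derive_cst_on (is_deriveD (dC s Js)
    (is_deriveZ alpha (is_deriveM (dp s Js) (dp s Js)))) oJ Js E.
  by rewrite /GRing.scale /= (dotC (b 2%N s)); lra.
have E2 : dot (b 2%N s0) (b 2%N s0) + dot (b 1%N s0) (b 3%N s0)
   + alpha * ((dot (g 1%N s0) (b 1%N s0) + dot (g 0%N s0) (b 2%N s0)) ^+ 2
     + dot (g 0%N s0) (b 1%N s0)
     * (dot (g 2%N s0) (b 1%N s0) + 2 * dot (g 1%N s0) (b 2%N s0)
        + dot (g 0%N s0) (b 3%N s0))) = 0.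
  have := is_derive_cst_on (is_deriveD (is_derive_dot (db 1 s0 Is0) (db 2 s0 Is0))
    (is_deriveZ alpha (is_deriveM (dp s0 Js0)
      (is_deriveD (is_derive_dot (dg 1 s0 Is0) (db 1 s0 Is0))
        (is_derive_dot (dg 0 s0 Is0) (db 2 s0 Is0)))))) oJ Js0 E1.
  by rewrite !fctE /GRing.scale /=; lra.
have [PE Ts _ d0] := key s0 Js0.
apply: (@ruled_jet_contradiction R alpha (g 0%N s0) (g 1%N s0) (g 2%N s0)
  (b 0%N s0) (b 1%N s0) (b 2%N s0) (b 3%N s0)) => //.
- exact: b00.
- exact: b01.
- by apply/eqP; rewrite -addr_eq0 addrC b02.
- exact: b03.
- exact: T'.
- by rewrite expr2 E.
- by rewrite -mulrA E1.
Unshelve. all: by end_near.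
Qed.

Lemma ruling_direction_derive_eq0 (alpha lambda : R) (M : set 'rV[R]_3)
    (N : 'rV[R]_3 -> 'rV[R]_3) (I : set R) (g b : R -> 'rV[R]_3) :
  alpha != 0 -> gauss_map M N -> self_similar alpha lambda M N ->
  ruling M I g b -> forall s, I s -> jet b 1 s = 0.
Proof.
move=> alpha0 gN HM rul; have [[oI _ _] [sg sb] b1 _ _] := rul.
apply: (@direction_derive_eq0 alpha lambda I (jet g) (jet b)) => //.
- by move=> k s; exact: is_derive_jet.
- by move=> k s; exact: is_derive_jet.
- by move=> s /b1/enorm1.
- exact: ruled_self_similar_eq gN HM rul.
Qed.

Lemma derive0_const (I : set R) (f : R^o -> 'rV[R]_3) : is_interval I ->
  (forall s, I s -> is_derive (s : R^o) (1 : R^o) f 0) ->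
  forall x y, I x -> I y -> f x = f y.
Proof.
move=> itvI f0 x y Ix Iy; apply/rowP => i.
apply: (interval_derive0_cst (f := fun s => f s 0 i) itvI) => // s Is.
by apply: is_derive_eq (is_derive_coord i (f0 s Is)) _; rewrite mxE.
Qed.

End Rigidity.

Theorem theorem1p2 (R : realType) (alpha lambda : R) (M : set 'rV[R]_3)
    (N : 'rV[R]_3 -> 'rV[R]_3) :
  alpha != 0 ->
  regular_surface M ->
  gauss_map M N ->
  self_similar alpha lambda M N ->
  ruled_surface M ->
  cylindrical_surface M.
Proof.
move=> alpha0 _ gN HM [I [g [b rul]]].
have b0 := ruling_direction_derive_eq0 alpha0 gN HM rul.
have [[_ itvI [s0 Is0]] [_ sb] _ _ _] := rul.
exists I, g, b; split=> //; exists (b s0) => s Is.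
apply: (derive0_const (I := I) (f := b)) => // t It.
by rewrite -(b0 t It); exact: (is_derive_jet 0 sb It).
Qed.
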